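(* Let $\Gamma$ be an abelian group with a bilinear map $\langle\,,\,\rangle:\Gamma\times\Gamma\to\mathbb{Z}_2$. Every simple associative $\Gamma$-commutative algebra $\mathcal{A}$ over $\mathbb{C}$ or $\mathbb{R}$ is even, that is, $\mathcal{A}=\mathcal{A}^0$.
   Context: $\Gamma$-commutative algebra: an algebra $\mathcal{A}$ that is $\Gamma$-graded, $\mathcal{A}=\bigoplus_{\gamma\in\Gamma}\mathcal{A}_\gamma$ with $\mathcal{A}_\gamma\cdot\mathcal{A}_{\gamma'}\subset\mathcal{A}_{\gamma+\gamma'}$, and such that $ab=(-1)^{\langle\bar a,\bar b\rangle}\,ba$ for all homogeneous $a,b$, where $\bar a,\bar b\in\Gamma$ denote the degrees. Bilinear means additive in each argument. Parity: for homogeneous $a$, $p(a)=\langle\bar a,\bar a\rangle\in\mathbb{Z}_2$; $a$ is even if $p(a)=0$ and odd if $p(a)=1$. $\mathcal{A}^0$ and $\mathcal{A}^1$ are the subspaces spanned by the even and the odd homogeneous elements respectively, so $\mathcal{A}=\mathcal{A}^0\oplus\mathcal{A}^1$ as a vector space. Simple: an algebra is called simple if it has no proper two-sided ideal, that is, no two-sided ideal other than $0$ and $\mathcal{A}$.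
   Formalization: The algebra is additionally assumed not to have identically zero product unless it is 0; without this the claim fails for the one-dimensional algebra with zero product placed in an odd degree. *)

(* Defs.v *)
From HB Require Import structures.
From mathcomp Require Import all_boot all_order all_algebra sesquilinear.
From mathcomp Require Import boolp classical_sets reals complex.
Set Implicit Arguments.
Unset Strict Implicit.
Unset Printing Implicit Defensive.
Import GRing.Theory.
Local Open Scope ring_scope.
Local Open Scope classical_set_scope.

Definition biadditive (Gamma : zmodType) (pairing : Gamma -> Gamma -> 'Z_2) :=
  (forall g h k, pairing (g + h) k = pairing g k + pairing h k) /\
  (forall g h k, pairing g (h + k) = pairing g h + pairing g k).

(* An algebra is a vector space A with a bilinear product [mul]; no unit and no
   finiteness of dimension is assumed, hence no [algType]. *)
Section Algebra.
Variables (F : fieldType) (A : lmodType F) (mul : {bilinear A -> A -> A}).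

Definition is_subspace (U : set A) : Prop :=
  U 0 /\ forall (c : F) (x y : A), U x -> U y -> U (c *: x + y).

Definition linear_span (X : set A) : set A := smallest is_subspace X.

Definition two_sided_ideal (I : set A) : Prop :=
  is_subspace I /\ forall a x, I x -> I (mul a x) /\ I (mul x a).

Definition simple_algebra : Prop :=
  forall I, two_sided_ideal I -> I = [set 0] \/ I = setT.

(* Satisfied by every algebra with a unit.  It fails for the one-dimensional
   algebra with zero product, which has no proper ideal and may be placed in an
   odd degree. *)
Definition not_null_algebra : Prop :=
  (forall x y, mul x y = 0) -> forall x : A, x = 0.

End Algebra.

Section Graded.
Variables (F : fieldType) (A : lmodType F) (mul : {bilinear A -> A -> A}).
Variables (Gamma : zmodType) (pairing : Gamma -> Gamma -> 'Z_2).
Variable comp : Gamma -> set A.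

Definition direct_sum_decomposition : Prop :=
  [/\ forall g, is_subspace (comp g),
      forall a, exists (s : seq Gamma) (x : Gamma -> A),
        (forall g, comp g (x g)) /\ a = \sum_(g <- s) x g
    & forall (s : seq Gamma) (x : Gamma -> A), uniq s ->
        (forall g, comp g (x g)) -> \sum_(g <- s) x g = 0 ->
        forall g, g \in s -> x g = 0].

Definition is_grading : Prop :=
  direct_sum_decomposition /\
  forall g h a b, comp g a -> comp h b -> comp (g + h) (mul a b).

Definition gamma_commutative : Prop :=
  is_grading /\
  forall g h a b, comp g a -> comp h b ->
    mul a b = (-1) ^+ (pairing g h : nat) *: mul b a.

Definition parity (g : Gamma) : 'Z_2 := pairing g g.

(* A^0 for i = 0 and A^1 for i = 1. *)
Definition parity_part (i : 'Z_2) : set A :=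
  linear_span [set a | exists g, comp g a /\ parity g = i].

Definition even_algebra : Prop := parity_part 0 = setT.

End Graded.

(* Main.v *)
Require Import Defs.
From HB Require Import structures.
From mathcomp Require Import all_boot all_order all_algebra sesquilinear.
From mathcomp Require Import boolp classical_sets reals complex.
Local Open Scope ring_scope.
Local Open Scope classical_set_scope.

(** The one-sided ideal generated by an odd homogeneous [a] squares to zero,
    which a simple algebra with nonzero product cannot tolerate.  Precisely,
    moving a homogeneous [a] past the homogeneous components of [x] changes only
    signs, so [a x] lies in [A a] for every [x] ([homogeneous_swap]); hence
    [A a] is a two-sided ideal.  If [a] is odd, commuting [a] with itself gives
    [a a = - a a], so [a a = 0] away from characteristic 2, and swapping once
    more gives [a x a = 0] for every [x].

    By simplicity [A a] is [A] or [0].  If it is [A], every product has the form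
    [(x a) (y a) = x (a y a) = 0].  If it is [0], then [a] is annihilated by [A]
    on both sides, so the line spanned by [a] is an ideal; it is either [0], and
    [a = 0], or all of [A], and again every product vanishes.  Since the product
    is not identically zero unless [A = 0], in all cases [a = 0]
    ([odd_homogeneous_eq0]): only even components survive in the decomposition
    of an element of [A].  Over both base fields the argument is the same,
    because it asks of the scalars only that 2 be nonzero. *)

Import GRing.Theory Num.Theory.

Section GammaCommutative.
Variables (F : fieldType) (A : lmodType F) (mul : {bilinear A -> A -> A}).
Variables (Gamma : zmodType) (pairing : Gamma -> Gamma -> 'Z_2).
Variable comp : Gamma -> set A.
Hypothesis mulA : associative mul.
Hypothesis comm : gamma_commutative mul pairing comp.

(** The witness is [x] with each homogeneous component multiplied by its
    commutation sign with [a].  This substitute for commutativity also holds for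
    non-homogeneous [x], which matters because ideals need not be graded. *)
Lemma homogeneous_swap {g a} x : comp g a -> exists y, mul a x = mul y a.
Proof.
move=> ga; case: comm => [[[_ dec _] _] swap].
have [s [z [hz ->]]] := dec x.
exists (\sum_(h <- s) (-1) ^+ (pairing g h : nat) *: z h).
rewrite linear_sumr linear_sumlz; apply: eq_bigr => h _.
by rewrite linearZl_LR (swap _ _ _ _ ga (hz h)).
Qed.

(** Stability on the right is the only issue: [(x a) y = x (a y)], and swapping
    turns [a y] into a left multiple of [a]. *)
Lemma ideal_left_multiples {g a} :
  comp g a -> two_sided_ideal mul (range (mul^~ a)).
Proof.
move=> ga; split; first split.
- by exists 0 => //; rewrite linear0l.
- move=> c _ _ [x _ <-] [y _ <-].
  by exists (c *: x + y) => //; rewrite linearPl.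
move=> y _ [x _ <-]; split; first by exists (mul y x).
have [z az] := homogeneous_swap y ga.
by exists (mul x z) => //; rewrite -!mulA az.
Qed.

Hypothesis two_neq0 : 2%:R != 0 :> F.

Lemma Z2_neq0_val {i : 'Z_2} : i != 0 -> i = 1%N :> nat.
Proof. by case: i => [[|[|m]]]. Qed.

Lemma odd_homogeneous_sqr0 {g a} : comp g a -> parity pairing g != 0 ->
  mul a a = 0.
Proof.
move=> ga /Z2_neq0_val odd_g; case: comm => _ /(_ _ _ _ _ ga ga).
rewrite odd_g expr1 scaleN1r => /eqP; rewrite -addr_eq0 -mulr2n -scaler_nat.
by rewrite scaler_eq0 (negbTE two_neq0) => /eqP.
Qed.

Lemma odd_homogeneous_sandwich0 {g a} x : comp g a -> parity pairing g != 0 ->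
  mul (mul a x) a = 0.
Proof.
move=> ga odd_g; have [y ->] := homogeneous_swap x ga.
by rewrite -mulA (odd_homogeneous_sqr0 ga odd_g) linear0r.
Qed.

Hypothesis not_null : not_null_algebra mul.
Hypothesis simple : simple_algebra mul.

(** Without a unit, [a] need not belong to [A a], so [A a = 0] does not by
    itself give [a = 0]; the line spanned by [a] settles that case. *)
Lemma odd_homogeneous_eq0 {g a} : comp g a -> parity pairing g != 0 -> a = 0.
Proof.
move=> ga odd_g; have [Aa0 | AaT] := simple _ (ideal_left_multiples ga); last first.
  apply: not_null => u v.
  have [x _ <-] : range (mul^~ a) u by rewrite AaT.
  have [y _ <-] : range (mul^~ a) v by rewrite AaT.
  by rewrite -mulA [mul a _]mulA (odd_homogeneous_sandwich0 _ ga odd_g) linear0r.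
have xa0 x : mul x a = 0.
  by have : range (mul^~ a) (mul x a) by [exists x]; rewrite Aa0.
have ax0 x : mul a x = 0 by have [y ->] := homogeneous_swap x ga.
have line_ideal : two_sided_ideal mul (range (fun c : F => c *: a)).
  split; first split.
  - by exists 0 => //; rewrite scale0r.
  - move=> c _ _ [x _ <-] [y _ <-].
    by exists (c * x + y) => //; rewrite scalerDl scalerA.
  by move=> y _ [c _ <-]; rewrite linearZr_LR linearZl_LR xa0 ax0 scaler0;
    split; exists 0; rewrite ?scale0r.
have [line0 | lineT] := simple _ line_ideal.
  by have : range (fun c : F => c *: a) a by [exists 1; rewrite ?scale1r];
    rewrite line0.
apply: not_null => u v.
have [c _ <-] : range (fun c : F => c *: a) u by rewrite lineT.
by rewrite linearZl_LR ax0 scaler0.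
Qed.

(** In a decomposition of an element into homogeneous components, the odd ones
    vanish and the even ones are generators of the even part. *)
Theorem simple_gamma_commutative_even : even_algebra pairing comp.
Proof.
apply/seteqP; split=> // a _ U [[U0 UD] evenU].
case: comm => [[[_ dec _] _] _]; have [s [x [hx ->]]] := dec a.
elim/big_ind: _ => // [u v Uu Uv|g _].
  by rewrite -[u]scale1r; apply: UD.
have [even_g|odd_g] := eqVneq (parity pairing g) 0.
  by apply: evenU; exists g.
by rewrite (odd_homogeneous_eq0 (hx g) odd_g).
Qed.

End GammaCommutative.

Theorem corollary2p4 (R : realType) (Gamma : zmodType)
    (pairing : Gamma -> Gamma -> 'Z_2) (hpairing : biadditive pairing) :
  (forall (A : lmodType R) (mul : {bilinear A -> A -> A})
      (comp : Gamma -> set A),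
    associative mul -> gamma_commutative mul pairing comp ->
    not_null_algebra mul -> simple_algebra mul ->
    even_algebra pairing comp) /\
  (forall (A : lmodType (complex R)) (mul : {bilinear A -> A -> A})
      (comp : Gamma -> set A),
    associative mul -> gamma_commutative mul pairing comp ->
    not_null_algebra mul -> simple_algebra mul ->
    even_algebra pairing comp).
Proof.
split=> A mul comp mulA comm not_null simple;
  by apply: (simple_gamma_commutative_even _ _ _ _ _ _ mulA comm _ not_null simple);
     rewrite pnatr_eq0.
Qed.
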